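(* ${\sf SCAC}$ is not strongly Weihrauch reducible to $\omega\text{-}{\sf SCAC}$, i.e. ${\sf SCAC}\not\le_{\mathrm{sW}}\omega\text{-}{\sf SCAC}$.
   Context: A poset $(P,\le_P)$ consists of $P\subseteq\omega$ and a reflexive, antisymmetric, transitive relation $\le_P$; chains (antichains) are sets of pairwise comparable (incomparable) elements; it is $\omega$-ordered if $x\le_P y$ implies $x\le y$. In an infinite poset, $x$ is small if $x\le_P y$ for all but finitely many $y\in P$, large if $y\le_P x$ for all but finitely many $y$, isolated if $x$ is incomparable with all but finitely many $y$; the poset is stable if every element is small or isolated, or every element is large or isolated. ${\sf SCAC}$ is the problem whose instances are infinite stable posets with $P\subseteq\omega$ and whose solutions are infinite chains or infinite antichains of the instance; $\omega\text{-}{\sf SCAC}$ is its restriction to $\omega$-ordered instances. $\mathsf P\le_{\mathrm{sW}}\mathsf Q$ means there are fixed Turing functionals $\Phi,\Psi$ such that for every $\mathsf P$-instance $X$, $\Phi^X$ is a $\mathsf Q$-instance and for every solution $\hat Y$ of $\Phi^X$, $\Psi^{\hat Y}$ is a solution of $X$. *)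

(* Defs.v *)
From mathcomp Require Import all_boot.
From mathcomp Require Import boolp classical_sets cardinality.
From Stdlib Require Cantor.

Set Implicit Arguments.
Unset Strict Implicit.
Unset Printing Implicit Defensive.

Local Open Scope classical_set_scope.

Definition npair (x y : nat) : nat := Cantor.to_nat (x, y).

(** Turing functionals are presented by Kleene's schemata for the functions
    that are partial recursive in an oracle.  All functions are unary; several
    arguments are passed through the Cantor pairing [npair], which is a
    bijection from pairs of naturals to naturals. *)
Inductive functional : Type :=
  | Zero
  | Succ
  | Fst
  | Snd
  | Oracle
  | Pair of functional & functional
  | Comp of functional & functional
  | Prec of functional & functional
  | Mu of functional.

(** [eval X e n m]: the computation of [e] with oracle [X] on input [n]
    converges, with output [m]. *)
Inductive eval (X : set nat) : functional -> nat -> nat -> Prop :=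
  | eval_zero n : eval X Zero n 0
  | eval_succ n : eval X Succ n n.+1
  | eval_fst x y : eval X Fst (npair x y) x
  | eval_snd x y : eval X Snd (npair x y) y
  | eval_oracle_in n : X n -> eval X Oracle n 1
  | eval_oracle_out n : ~ X n -> eval X Oracle n 0
  | eval_pair f g n x y :
      eval X f n x -> eval X g n y -> eval X (Pair f g) n (npair x y)
  | eval_comp f g n x y :
      eval X g n x -> eval X f x y -> eval X (Comp f g) n y
  | eval_prec0 f g a x :
      eval X f a x -> eval X (Prec f g) (npair a 0) x
  | eval_precS f g a k x y :
      eval X (Prec f g) (npair a k) x ->
      eval X g (npair a (npair k x)) y ->
      eval X (Prec f g) (npair a k.+1) y
  (* [v] records the nonzero values (minus one) taken before the first zero. *)
  | eval_mu f a k (v : nat -> nat) :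
      (forall j, j < k -> eval X f (npair a j) (v j).+1) ->
      eval X f (npair a k) 0 ->
      eval X (Mu f) a k.

(** [e] with oracle [X] is total and is the characteristic function of [Y]. *)
Definition computes (e : functional) (X Y : set nat) : Prop :=
  forall n, (Y n -> eval X e n 1) /\ (~ Y n -> eval X e n 0).

Record problem : Type := Problem {
  instance : set (set nat);
  solution : set nat -> set (set nat) (* [solution X Y]: [Y] solves [X] *)
}.

Definition sW_reducible (P Q : problem) : Prop :=
  exists Phi Psi : functional,
    forall X, instance P X ->
      exists X', [/\ computes Phi X X',
                     instance Q X' &
                     forall Y', solution Q X' Y' ->
                       exists2 Y, computes Psi Y' Y & solution P X Y].

Section Poset.
Variables (P : set nat) (le : nat -> nat -> Prop).

(** The relation is a subset of [P * P]. *)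
Definition is_poset : Prop :=
  [/\ forall x y, le x y -> P x /\ P y,
      forall x, P x -> le x x,
      forall x y, le x y -> le y x -> x = y &
      forall x y z, le x y -> le y z -> le x z].

Definition comparable (x y : nat) : Prop := le x y \/ le y x.

Definition chain (S : set nat) : Prop :=
  S `<=` P /\ forall x y, S x -> S y -> comparable x y.

Definition antichain (S : set nat) : Prop :=
  S `<=` P /\ forall x y, S x -> S y -> x <> y -> ~ comparable x y.

Definition omega_ordered : Prop := forall x y, le x y -> x <= y.

Definition almost_all (Q : set nat) : Prop := finite_set (P `\` Q).

Definition small (x : nat) : Prop := almost_all [set y | le x y].
Definition large (x : nat) : Prop := almost_all [set y | le y x].
Definition isolated (x : nat) : Prop := almost_all [set y | ~ comparable x y].

Definition stable : Prop :=
  (forall x, P x -> small x \/ isolated x) \/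
  (forall x, P x -> large x \/ isolated x).

End Poset.

(** A pair [(P, le)] with [P] a set of naturals and [le] a binary relation on
    the naturals is coded by the join of [P] with the set of all [npair x y]
    such that [le x y].  Every set of naturals codes exactly one such pair,
    recovered by [carrier] and [order]. *)
Definition carrier (X : set nat) : set nat := [set x | X x.*2].
Definition order (X : set nat) (x y : nat) : Prop := X (npair x y).*2.+1.

Definition SCAC : problem := {|
  instance := [set X | [/\ is_poset (carrier X) (order X),
                           infinite_set (carrier X) &
                           stable (carrier X) (order X)]];
  solution := fun X => [set S | infinite_set S /\
                (chain (carrier X) (order X) S \/
                 antichain (carrier X) (order X) S)]
|}.

Definition omega_SCAC : problem := {|
  instance := instance SCAC `&` [set X | omega_ordered (order X)];
  solution := solution SCAC
|}.

(* Main.v *)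
(** Suppose (Phi, Psi) is a reduction and write Q(X) for Phi^X.  Every element
    of a stable poset is comparable to almost all elements or incomparable to
    almost all of them; call this its type.  An infinite chain contains only
    elements of the first type, an infinite antichain only of the second, and
    two elements of a solution reveal by their comparability which case holds.

    If Q(X) has infinitely many elements of type b, they contain a homogeneous
    solution, and Psi outputs two elements v, w from a finite part c of it.
    Changing the type of w beyond a long initial segment of X to the one that
    contradicts the comparability of v and w gives X' such that, if Q(X') still
    has infinitely many elements of type b, then some element of c has the
    other type in Q(X').  Doing this infinitely often, for both b, produces an
    X whose Q(X) has infinitely many elements of each type.

    In such a Q(X), choose a finite chain c as above and then a finite antichain
    c' as above lying over c, giving distinct outputs w and w'.  As stable
    posets may use either small or large elements, and w, w' are comparable in
    at most one direction, both can be given the wrong type at once.  Extend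
    this again to X with both types infinite in Q(X): some x in c is isolated
    and some y in c' is small, but x <= y in Q(X) and Q(X) is omega-ordered, so
    x is small. *)

From mathcomp Require Import all_boot zify.
From mathcomp Require Import boolp classical_sets cardinality.
From Stdlib Require Cantor.
Require Import Defs.

Set Implicit Arguments.
Unset Strict Implicit.
Unset Printing Implicit Defensive.

Local Open Scope classical_set_scope.

(** * Determinism and use of oracle computations *)

Lemma npair_inj x y x' y' : npair x y = npair x' y' -> x = x' /\ y = y'.
Proof. by move=> /Cantor.to_nat_inj[]. Qed.

Lemma leq_npair x y : x <= npair x y /\ y <= npair x y.
Proof. have := Cantor.to_nat_non_decreasing x y; rewrite /npair; lia. Qed.

Lemma eval_PrecE X f g p y : eval X (Prec f g) p y -> exists a,
  (p = npair a 0 /\ eval X f a y) \/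
  exists k x, [/\ p = npair a k.+1, eval X (Prec f g) (npair a k) x &
    eval X g (npair a (npair k x)) y].
Proof.
move=> E; inversion E as [| | | | | | | |? ? a x|? ? a k x|]; subst.
  by exists a; left.
by exists a; right; exists k, x.
Qed.

Lemma eval_det X e n m m' : eval X e n m -> eval X e n m' -> m = m'.
Proof.
move=> E; elim: E m' => {e n m}.
- by move=> n m' E; inversion E.
- by move=> n m' E; inversion E.
- by move=> x y m' E; inversion E; have [] := npair_inj H; congruence.
- by move=> x y m' E; inversion E; have [] := npair_inj H; congruence.
- by move=> n Xn m' E; inversion E.
- by move=> n Xn m' E; inversion E.
- move=> f g n x y _ IHf _ IHg m' E; inversion E; subst.
  by congr npair; [apply: IHf|apply: IHg].
- move=> f g n x y _ IHg _ IHf m' E; inversion E; subst.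
  by apply: IHf; rewrite (IHg x0).
- move=> f g a x _ IH m' /eval_PrecE[a' [[/npair_inj[<- _]]|[k' [x' []]]]] //.
    exact: IH.
  by move=> /npair_inj[].
- move=> f g a k x y _ IHx _ IHy m' /eval_PrecE[a' [[/npair_inj[]]|[k' [x' []]]]] //.
  by move=> /npair_inj[<- [<-]] /IHx <- /IHy.
- move=> f a k v _ IHv _ IH0 m' E; inversion E as [| | | | | | | | | |? ? ? v' Hv Hk]; subst.
  (* If the searches stopped at different places, the later one would have recorded a nonzero value
     where the earlier one found zero. *)
  have [lt|gt|//] := ltngtP k m'.
    by have /IH0 := Hv _ lt.
  by have := IHv _ gt _ Hk.
Qed.

Definition agree (k : nat) (X X' : set nat) : Prop :=
  forall z, z < k -> (X z <-> X' z).

Lemma agreeW k k' X X' : k <= k' -> agree k' X X' -> agree k X X'.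
Proof. by move=> lek ag z ltz; apply: ag; apply: leq_trans lek. Qed.

Lemma uniform_bound (F : nat -> nat -> Prop) n :
    (forall j k k', k <= k' -> F j k -> F j k') ->
    (forall j, j < n -> exists k, F j k) ->
  exists k, forall j, j < n -> F j k.
Proof.
move=> mono; elim: n => [|n IH] exF; first by exists 0.
have [k Fk] := IH (fun j lt => exF j (ltnW lt)).
have [k' Fk'] := exF n (ltnSn n).
exists (maxn k k') => j; rewrite ltnS leq_eqVlt => /orP[/eqP ->|lt].
  by apply: mono Fk'; apply: leq_maxr.
by apply: mono (Fk _ lt); apply: leq_maxl.
Qed.

Lemma eval_use X e n m :
  eval X e n m -> exists k, forall X', agree k X X' -> eval X' e n m.
Proof.
move=> E; elim: E => {e n m}.
- by move=> n; exists 0 => X' _; constructor.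
- by move=> n; exists 0 => X' _; constructor.
- by move=> x y; exists 0 => X' _; constructor.
- by move=> x y; exists 0 => X' _; constructor.
- by move=> n Xn; exists n.+1 => X' ag; constructor; apply/(ag n).
- by move=> n Xn; exists n.+1 => X' ag; constructor => /(ag n (ltnSn n)).
- move=> f g n x y _ [k Hk] _ [l Hl]; exists (maxn k l) => X' ag.
  by constructor; [apply: Hk|apply: Hl]; apply: agreeW ag;
    [apply: leq_maxl|apply: leq_maxr].
- move=> f g n x y _ [k Hk] _ [l Hl]; exists (maxn k l) => X' ag.
  by apply: (eval_comp (x := x)); [apply: Hk|apply: Hl]; apply: agreeW ag;
    [apply: leq_maxl|apply: leq_maxr].
- by move=> f g a x _ [k Hk]; exists k => X' ag; constructor; apply: Hk.
- move=> f g a k x y _ [l Hl] _ [l' Hl']; exists (maxn l l') => X' ag.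
  by apply: (eval_precS (x := x)); [apply: Hl|apply: Hl']; apply: agreeW ag;
    [apply: leq_maxl|apply: leq_maxr].
- move=> f a k v _ IHv _ [l Hl].
  (* The search makes finitely many tests before its first zero, so their uses have a common
     bound. *)
  have [||l' Hl'] := @uniform_bound (fun j l => forall X', agree l X X' ->
      eval X' f (npair a j) (v j).+1) k; last 1 first.
  + exists (maxn l l') => X' ag.
    apply: (eval_mu (v := v)) => [j lt|].
      by apply: (Hl' _ lt); apply: agreeW ag; apply: leq_maxr.
    by apply: Hl; apply: agreeW ag; apply: leq_maxl.
  + by move=> j i i' lei Hi X' ag; apply: Hi; apply: agreeW ag.
  + by [].
Qed.

Lemma computes_in e X Y n : computes e X Y -> eval X e n 1 -> Y n.
Proof.
move=> eY e1; apply: contrapT => nY.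
by have := eval_det e1 ((eY n).2 nY).
Qed.

Lemma computes_use e X Y k : computes e X Y ->
  exists u, forall X' Y', agree u X X' -> computes e X' Y' -> agree k Y Y'.
Proof.
move=> eY.
have [||u Hu] := @uniform_bound (fun z u => forall X' Y', agree u X X' ->
    computes e X' Y' -> (Y z <-> Y' z)) k; last 1 first.
- by exists u => X' Y' ag eY' z ltz; apply: Hu eY'.
- by move=> j i i' lei Hi X' Y' ag; apply: Hi; apply: agreeW ag.
move=> z _; have [Yz|nYz] := pselect (Y z).
  have [u Hu] := eval_use ((eY z).1 Yz).
  by exists u => X' Y' /Hu e1 eY'; split=> // _; apply: computes_in e1.
have [u Hu] := eval_use ((eY z).2 nYz).
exists u => X' Y' /Hu e0 eY'; split=> // Y'z.
by have := eval_det e0 ((eY' z).1 Y'z).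
Qed.

(** * Greedy construction of homogeneous sets *)

Lemma finite_natP (A : set nat) :
  finite_set A <-> exists m, forall y, A y -> y < m.
Proof.
split=> [/finite_seqP[s ->]|[m Am]].
  exists (\max_(i <- s) i).+1 => y /= ys.
  by rewrite ltnS (big_rem y) //= leq_maxl.
by apply: (sub_finite_set (B := `I_m)) (finite_II m) => y /= /Am.
Qed.

Lemma infinite_natP (A : set nat) :
  infinite_set A <-> forall m, exists2 y, m <= y & A y.
Proof.
split=> [infA m|cofA /finite_natP[m Am]].
  apply: contrapT => nex; apply: infA; apply/finite_natP; exists m => y Ay.
  by rewrite ltnNge; apply/negP => lemy; apply: nex; exists y.
by have [y ley /Am] := cofA m; rewrite ltnNge ley.
Qed.

Lemma almost_allP (P A : set nat) :
  almost_all P A <-> exists m, forall y, m <= y -> P y -> A y.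
Proof.
rewrite /almost_all finite_natP; split=> -[m Hm]; exists m => y.
  by move=> ley Py; apply: contrapT => nAy; have := Hm y (conj Py nAy); rewrite ltnNge ley.
by case=> Py nAy; rewrite ltnNge; apply/negP => ley; apply: nAy; apply: Hm.
Qed.

Fixpoint greedy_below (T : set nat) (R : nat -> nat -> Prop) (c : set nat)
    (k n : nat) : set nat :=
  if n is n'.+1 then
    greedy_below T R c k n' `|` [set x | x = n' /\
      if n' < k then c n'
      else T n' /\ forall z, greedy_below T R c k n' z -> R z n']
  else set0.

Definition greedy T R c k : set nat := [set x | greedy_below T R c k x.+1 x].

Lemma greedy_belowE T R c k n x :
  greedy_below T R c k n x <-> x < n /\ greedy T R c k x.
Proof.
have lt_below i z : greedy_below T R c k i z -> z < i.
  by elim: i => [|i IH] //= [/IH|[->]] //; lia.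
elim: n => [|n IH]; first by split=> // -[].
split=> [/= [/IH[ltx gx]|[-> Hn]]|[]].
- by split=> //; lia.
- by split; [lia|right].
- rewrite ltnS leq_eqVlt => /orP[/eqP ->//|ltx] gx.
  by left; apply/IH.
Qed.

Lemma greedyE T R c k n : greedy T R c k n <->
  if n < k then c n else T n /\ forall z, z < n -> greedy T R c k z -> R z n.
Proof.
split=> [[/greedy_belowE[]|[_]]|Hn]; rewrite ?ltnn //.
- case: ifP => // _ [Tn Rn]; split=> // z ltz gz.
  by apply: Rn; apply/greedy_belowE.
- right; split=> //; move: Hn; case: ifP => // _ [Tn Rn]; split=> // z.
  by move=> /greedy_belowE[]; apply: Rn.
Qed.

(** Copy [c] below [k], then accept each element of [T] that is related to everything accepted so
    far. Were the result bounded, its finitely many members would have a common limit bound, and an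
    element of [T] past it would be accepted. Agreement with [c] below [k] preserves oracle
    computations of use [k]. *)
Lemma homogeneous_extension (T : set nat) (R : nat -> nat -> Prop) (c : set nat) (k : nat) :
    infinite_set T ->
    (forall x, T x -> exists m, forall y, m <= y -> T y -> R x y) ->
    (forall x, c x -> x < k /\ T x) ->
    (forall x y, c x -> c y -> x < y -> R x y) ->
  exists C, [/\ infinite_set C, C `<=` T, forall x, x < k -> (c x <-> C x) &
    forall x y, C x -> C y -> x < y -> R x y].
Proof.
move=> /infinite_natP infT limR cT cR.
pose C := greedy T R c k.
have CT : C `<=` T.
  by move=> x /greedyE; case: ifP => [_ /cT[]|_ []].
have Cc x : x < k -> (c x <-> C x).
  by move=> ltx; rewrite /C greedyE ltx.
exists C; split=> // [|x y Cx /greedyE]; last first.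
  case: ifP => [lty cy ltxy|_ [_ Ry] ltxy]; last exact: Ry.
  by apply: cR => //; apply/Cc => //; apply: ltn_trans lty.
apply/infinite_natP => m; apply: contrapT => nex.
have Cm z : C z -> z < maxn m k.
  move=> Cz; rewrite ltnNge; apply/negP => lez; apply: nex; exists z => //.
  by apply: leq_trans lez; apply: leq_maxl.
have [||l Hl] := @uniform_bound (fun z l => C z -> forall y, l <= y -> T y -> R z y)
    (maxn m k).
- by move=> j i i' lei Hi Cj y ley; apply: Hi => //; apply: leq_trans ley.
- move=> z _; have [Cz|nCz] := pselect (C z); last by exists 0.
  by have [l Hl] := limR z (CT z Cz); exists l.
have [y ley Ty] := infT (maxn l (maxn m k)).
have lely : l <= y by apply: leq_trans ley; apply: leq_maxl.
have lemy : maxn m k <= y by apply: leq_trans ley; apply: leq_maxr.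
suff /Cm : C y by rewrite ltnNge lemy.
apply/greedyE; rewrite ifF; last first.
  by apply/negbTE; rewrite -leqNgt; apply: leq_trans lemy; apply: leq_maxr.
by split=> // z _ Cz; apply: Hl => //; apply: Cm.
Qed.

(** * Limit types in stable posets *)

Definition rel_if (b : bool) (le : nat -> nat -> Prop) (x y : nat) : Prop :=
  if b then comparable le x y else ~ comparable le x y.

Lemma rel_if_sym b le x y : rel_if b le x y -> rel_if b le y x.
Proof. by rewrite /rel_if /comparable; case: b; tauto. Qed.

Lemma rel_ifN b le x y : rel_if b le x y -> rel_if (~~ b) le x y -> False.
Proof. by case: b; rewrite /rel_if /=; tauto. Qed.

(** Type [true] merges small and large, so that both kinds of stability are treated at once. *)
Definition limit_type (b : bool) (Z : set nat) : set nat :=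
  [set x | carrier Z x /\
    exists m, forall y, m <= y -> carrier Z y -> rel_if b (order Z) x y].

Lemma limit_typeN b Z x : infinite_set (carrier Z) ->
  limit_type b Z x -> limit_type (~~ b) Z x -> False.
Proof.
move=> /infinite_natP infZ [_ [m Hm]] [_ [m' Hm']].
have [y ley Zy] := infZ (maxn m m').
by apply: (@rel_ifN b (order Z) x y); [apply: Hm|apply: Hm'] => //;
  apply: leq_trans ley; [apply: leq_maxl|apply: leq_maxr].
Qed.

Lemma limit_type_total Z x : instance SCAC Z -> carrier Z x ->
  exists b, limit_type b Z x.
Proof.
have nonisolated (A : set nat) : carrier Z x -> A `<=` [set y | comparable (order Z) x y] ->
    almost_all (carrier Z) A -> exists b, limit_type b Z x.
  move=> Zx sA /almost_allP[m Hm]; exists true; split=> //; exists m => y ley Zy.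
  by apply: sA; apply: Hm.
have iso : carrier Z x -> isolated (carrier Z) (order Z) x ->
    exists b, limit_type b Z x.
  by move=> Zx /almost_allP[m Hm]; exists false; split=> //; exists m.
move=> [_ _ [] st] Zx; have [|] := st x Zx => //.
- by apply: nonisolated => // y; left.
- exact: iso.
- by apply: nonisolated => // y; right.
- exact: iso.
Qed.

Lemma homogeneous_solution b Z S : instance SCAC Z -> infinite_set S ->
  S `<=` carrier Z -> (forall x y, S x -> S y -> x < y -> rel_if b (order Z) x y) ->
  solution SCAC Z S.
Proof.
move=> [[_ refl _ _] _ _] infS SZ homS; split=> //.
have hom x y : S x -> S y -> x <> y -> rel_if b (order Z) x y.
  move=> Sx Sy /eqP; rewrite neq_ltn => /orP[lt|lt]; first exact: homS.
  by apply: rel_if_sym; apply: homS.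
case: b {homS} hom => hom; [left|right]; split=> // x y Sx Sy.
by have [->|ne] := pselect (x = y); [left; apply/refl/SZ|apply: hom].
Qed.

(** The pair [v], [w] decides whether [S] is a chain or an antichain, and far elements of [S] then
    relate to [w] in the same way. *)
Lemma solution_limit_type b Z S v w : solution SCAC Z S -> S v -> S w -> v <> w ->
  rel_if b (order Z) v w -> ~ limit_type (~~ b) Z w.
Proof.
move=> [/infinite_natP infS homS] Sv Sw vw rvw [_ [m Hm]].
have [y ley Sy] := infS (maxn m w.+1).
have /Hm rwy : m <= y by apply: leq_trans ley; apply: leq_maxl.
have lty : w < y by apply: leq_trans ley; apply: leq_maxr.
have wy : w <> y by lia.
case: homS => -[SZ homS]; have {Hm}rwy := rwy (SZ _ Sy).
  by case: b rvw rwy => /= rvw rwy; [apply: rwy|apply: rvw]; apply: homS.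
case: b rvw rwy => /= rvw rwy; first exact: homS vw rvw.
exact: homS wy rwy.
Qed.

Lemma limit_type_homogeneous b Z c k : instance SCAC Z ->
    infinite_set (limit_type b Z) ->
    (forall x, c x -> x < k /\ limit_type b Z x) ->
    (forall x y, c x -> c y -> x < y -> rel_if b (order Z) x y) ->
  exists C, [/\ solution SCAC Z C, C `<=` limit_type b Z,
    forall x, x < k -> (c x <-> C x) &
    forall x y, C x -> C y -> x < y -> rel_if b (order Z) x y].
Proof.
move=> instZ infT cT homc.
have [|C [infC CT Cc homC]] := homogeneous_extension infT _ cT homc.
  by move=> x [_ [m Hm]]; exists m => y ley [Zy _]; apply: Hm.
exists C; split=> //; apply: homogeneous_solution homC => //.
by move=> x /CT[].
Qed.

(** * Finite commitments made by a reduction *)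

Definition reduces (Phi Psi : functional) (Q : set nat -> set nat) : Prop :=
  forall X, instance SCAC X ->
    [/\ computes Phi X (Q X), instance omega_SCAC (Q X) &
        forall Y', solution SCAC (Q X) Y' ->
          exists2 Y, computes Psi Y' Y & solution SCAC X Y].

Definition agree_pairs (k : nat) (X X' : set nat) : Prop :=
  (forall x, x < k -> (carrier X x <-> carrier X' x)) /\
  forall x y, x < k -> y < k -> (order X x y <-> order X' x y).

Lemma agree_to_pairs k : exists u, forall X X', agree u X X' -> agree_pairs k X X'.
Proof.
have [||u Hu] := @uniform_bound (fun x u => forall y, y < k ->
    x.*2 < u /\ (npair x y).*2.+1 < u) k; last 1 first.
- exists u => X X' ag; split=> [x ltx|x y ltx lty]; apply: ag.
    by have [] := Hu x ltx x ltx.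
  by have [] := Hu x ltx y lty.
- by move=> x i i' lei Hi y /Hi; lia.
move=> x _; have [||u Hu] := @uniform_bound (fun y u =>
    x.*2 < u /\ (npair x y).*2.+1 < u) k; last by exists u.
- by move=> y i i' lei; lia.
- by move=> y _; exists (x + npair x y).+1.*2; lia.
Qed.

Lemma reduces_use Phi Psi Q X k : reduces Phi Psi Q -> instance SCAC X ->
  exists u, forall X', instance SCAC X' -> agree u X X' -> agree_pairs k (Q X) (Q X').
Proof.
move=> red instX; have [k' Hk'] := agree_to_pairs k.
have [compX _ _] := red X instX.
have [u Hu] := computes_use k' compX.
exists u => X' /red[compX' _ _] ag; apply: Hk'; exact: Hu compX'.
Qed.

(* [d] records whether the two outputs of [Psi] found on [c] are comparable, so
   that [~~ d] is the type that [w] has in no [X'] where [c] is part of a solution. *)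
Lemma commitment Phi Psi Q b X j n : reduces Phi Psi Q -> instance SCAC X ->
    infinite_set (limit_type b (Q X)) ->
  exists c w d u k,
    [/\ forall x, c x -> [/\ j <= x, x < k & limit_type b (Q X) x], n <= w &
    forall X', instance SCAC X' -> agree u X X' ->
      infinite_set (limit_type b (Q X')) -> limit_type (~~ d) X' w ->
      exists2 x, c x & limit_type (~~ b) (Q X') x].
Proof.
move=> red instX infX; have [_ [instQ _] solQ] := red X instX.
(* The empty set prescribed below [j] keeps [C] from having elements there. *)
have [||C [solC CT C0 homC]] := @limit_type_homogeneous b (Q X) set0 j instQ infX => //.
have [Y compY [/infinite_natP infY _]] := solQ C solC.
have [v lev Yv] := infY n; have [w lew Yw] := infY v.+1.
have [kv Hkv] := eval_use ((compY v).1 Yv).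
have [kw Hkw] := eval_use ((compY w).1 Yw).
pose k := maxn kv kw.
have [d rvw] : exists d, rel_if d (order X) v w.
  by have [|] := pselect (comparable (order X) v w); [exists true|exists false].
have [u1 Hu1] := reduces_use k red instX.
have [u2 Hu2] := agree_to_pairs w.+1.
exists (C `&` [set x | x < k]), w, d, (maxn u1 u2), k; split.
- move=> x [Cx ltx]; split=> //; last exact: CT.
  by rewrite leqNgt; apply/negP => /C0[_ /(_ Cx)].
- by lia.
move=> X' instX' ag infX' typew; apply: contrapT => ncommit.
have [agZ agO] := Hu1 X' instX' (agreeW (leq_maxl _ _) ag).
have [_ agX] := Hu2 _ _ (agreeW (leq_maxr _ _) ag).
have [_ [instQ' _] solQ'] := red X' instX'.
have agR e x y : x < k -> y < k ->
    rel_if e (order (Q X)) x y -> rel_if e (order (Q X')) x y.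
  by move=> ltx lty; have := agO x y ltx lty; have := agO y x lty ltx;
    case: e; rewrite /rel_if /comparable; tauto.
(* If no element of [c] changes type, [c] still extends to a solution, now of [Q X']. It agrees with
   [C] below the use [k], so [Psi] again outputs [v] and [w]. *)
have [||C' [solC' _ CC' _]] :=
    @limit_type_homogeneous b (Q X') (C `&` [set x | x < k]) k instQ' infX'.
- move=> x [Cx ltx]; split=> //.
  have /(limit_type_total instQ')[e typex] : carrier (Q X') x.
    by apply/agZ => //; have [] := CT x Cx.
  have [->//|ne] := eqVneq b e; case: ncommit; exists x => //.
  suff -> : ~~ b = e by [].
  by move: ne; case: (b); case: (e).
- by move=> x y [Cx ltx] [Cy lty] ltxy; apply: agR => //; apply: homC.
have agC : agree k C C' by move=> x ltx; rewrite -CC' //; split=> [|[]].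
have [Y' compY' solY'] := solQ' C' solC'.
have Y'v : Y' v by apply: computes_in compY' (Hkv _ (agreeW (leq_maxl _ _) agC)).
have Y'w : Y' w by apply: computes_in compY' (Hkw _ (agreeW (leq_maxr _ _) agC)).
apply: (solution_limit_type solY' Y'v Y'w _ _ typew); first by lia.
have ltv : v < w.+1 by lia.
have := agX v w ltv (ltnSn w); have := agX w v (ltnSn w) ltv.
by move: rvw; case: d {typew}; rewrite /rel_if /comparable; tauto.
Qed.

(** Past [y], an element comparable to [y] can only be above it, hence is above [x] too. *)
Lemma limit_type_incr Z x y : instance omega_SCAC Z -> order Z x y ->
  limit_type true Z y -> limit_type true Z x.
Proof.
move=> [[[sub _ _ trans] _ _] omega] lexy [_ [m Hm]].
split; first by have [] := sub _ _ lexy.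
exists (maxn m y.+1) => z lez Zz; left.
have [||leyz|/omega] := Hm z => //; last by lia.
  by apply: leq_trans lez; apply: leq_maxl.
exact: trans leyz.
Qed.

(** * Coding orders on all naturals, in either orientation *)

(* [m = false] gives the dual order, turning small elements into large ones. *)
Definition oriented (m : bool) (le : nat -> nat -> Prop) (x y : nat) : Prop :=
  if m then le x y else le y x.

(** Even positions belong vacuously, which makes the carrier all of the naturals. *)
Definition code (m : bool) (le : nat -> nat -> Prop) : set nat :=
  [set z | odd z -> oriented m le (Cantor.of_nat z./2).1 (Cantor.of_nat z./2).2].

Lemma carrier_code m le : carrier (code m le) = setT.
Proof. by apply/seteqP; split=> // x _; rewrite /carrier /code /= odd_double. Qed.

Lemma order_code m le : order (code m le) = oriented m le.
Proof.
apply/funext => x; apply/funext => y; apply/propext.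
rewrite /order /code /= odd_double uphalf_double /npair Cantor.cancel_of_to /=.
by split=> // /(_ isT).
Qed.

Lemma rel_if_oriented b m le x y : rel_if b (oriented m le) x y <-> rel_if b le x y.
Proof. by rewrite /rel_if /comparable; case: b; case: m => /=; tauto. Qed.

(** The components of a pair do not exceed its code, so bits below [u] mention only numbers below
    [u]. *)
Lemma agree_code u m m' le le' :
    (forall x y, x < u -> y < u -> (oriented m le x y <-> oriented m' le' x y)) ->
  agree u (code m le) (code m' le').
Proof.
move=> H z ltz; rewrite /code /=; case E : (Cantor.of_nat z./2) => [x y] /=.
have Ez : z./2 = npair x y by rewrite /npair -E Cantor.cancel_to_of.
have [lex ley] := leq_npair x y.
have half_le : z./2 <= z by rewrite leq_half_double; lia.
by have := H x y; split=> Hz /Hz; apply H; lia.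
Qed.

Lemma poset_oriented m le : is_poset setT le -> is_poset setT (oriented m le).
Proof.
case: m => // -[_ refl anti trans]; split=> //= [x y lxy lyx|x y z lxy lyz].
- exact: anti.
- exact: trans lxy.
Qed.

Definition stable_up (le : nat -> nat -> Prop) : Prop :=
  forall x, (exists m, forall y, m <= y -> le x y) \/
            (exists m, forall y, m <= y -> ~ comparable le x y).

Lemma code_instance m le : is_poset setT le -> stable_up le ->
  instance SCAC (code m le).
Proof.
move=> ple st; rewrite /= carrier_code order_code; split.
- exact: poset_oriented.
- exact: infinite_nat.
have iso x : (exists l, forall y, l <= y -> ~ comparable le x y) ->
    isolated setT (oriented m le) x.
  move=> [l Hl]; apply/almost_allP; exists l => y ley _.
  exact/(@rel_if_oriented false)/Hl.
case: m iso => iso; [left|right] => x _; have [[l Hl]|/iso] := st x.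
- by left; apply/almost_allP; exists l => y ley _; apply: Hl.
- by right.
- by left; apply/almost_allP; exists l => y ley _; apply: Hl.
- by right.
Qed.

(** * Forcing conditions and their realizations *)

(* A condition stands for the restriction of [below] to numbers less than
   [bound], with the promise that an element of [small_part] is below all
   numbers from [bound] on and any other element is incomparable to them. *)
Record condition : Type := Condition {
  bound : nat;
  below : nat -> nat -> Prop;
  small_part : set nat
}.

(** The closure clause makes the promise consistent with transitivity: what lies under a small
    element must itself be small. *)
Definition valid (p : condition) : Prop :=
  is_poset setT (below p) /\
  forall x y, x < bound p -> y < bound p -> below p x y ->
    small_part p y -> small_part p x.

Definition settled (le : nat -> nat -> Prop) (N : set nat) (x y : nat) : Prop :=
  (N x -> le x y) /\ (~ N x -> ~ comparable le x y).

(** The cutoff [k] lets one notion serve both a longer condition, with [k] its bound, and a full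
    order, with every [k]. *)
Definition extends_upto (k : nat) (p : condition) (le : nat -> nat -> Prop) : Prop :=
  (forall x y, x < bound p -> y < bound p -> (below p x y <-> le x y)) /\
  (forall x y, x < bound p -> bound p <= y -> y < k -> settled le (small_part p) x y).

Definition stronger (q p : condition) : Prop :=
  [/\ bound p <= bound q, extends_upto (bound q) p (below q) &
      forall x, x < bound p -> (small_part q x <-> small_part p x)].

Definition realization (p : condition) (le : nat -> nat -> Prop) : Prop :=
  [/\ is_poset setT le, stable_up le & forall k, extends_upto k p le].

Lemma stronger_refl p : stronger p p.
Proof. by split=> //; split=> // x y _ ley lty; lia. Qed.

Lemma extends_upto_stronger k p q le :
  stronger q p -> extends_upto k q le -> extends_upto k p le.
Proof.
move=> [lepq [qp1 qp2] Nqp] [rq1 rq2]; split=> [x y ltx lty|x y ltx ley lty].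
  have ltx' := leq_trans ltx lepq; have lty' := leq_trans lty lepq.
  by rewrite qp1 // rq1.
have ltx' := leq_trans ltx lepq.
have [lt|ge] := ltnP y (bound q).
  have := qp2 x y ltx ley lt; rewrite /settled /comparable.
  by rewrite !rq1.
by have := rq2 x y ltx' ge lty; rewrite /settled Nqp.
Qed.

Lemma stronger_trans p q r : stronger q p -> stronger r q -> stronger r p.
Proof.
move=> qp [leqr rq Nrq]; have [lepq _ Nqp] := qp; split.
- exact: leq_trans leqr.
- exact: extends_upto_stronger rq.
- by move=> x ltx; rewrite Nrq ?Nqp //; apply: leq_trans lepq.
Qed.

Lemma realization_stronger p q le :
  stronger q p -> realization q le -> realization p le.
Proof.
by move=> qp [ple st ext]; split=> // k; apply: extends_upto_stronger (ext k).
Qed.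

(** Let the numbers from the bound on be pairwise incomparable, and put only the promised small
    elements under them. *)
Lemma realization_exists p : valid p -> exists le, realization p le.
Proof.
move=> [[_ refl anti trans] closed]; set n := bound p in closed *.
pose le x y := [\/ [/\ x < n, y < n & below p x y], x = y |
  [/\ x < n, n <= y & small_part p x]].
exists le; split.
- split=> // [x _|x y|x y z]; first exact: Or32.
    case=> [[ltx lty lxy]|->|[ltx ley Nx]] //.
      by case=> [[_ _]|->|[]] //; [apply: anti|lia].
    by case=> [[]|->|[]] //; lia.
  case=> [[ltx lty lxy]|->//|[ltx ley Nx]]; case=> [[lty' ltz lyz]|<-|[lty' lez Ny]];
    try (exfalso; lia).
  + by apply: Or31; split=> //; apply: trans lyz.
  + exact: Or31.
  + by apply: Or33; split=> //; apply: closed lxy Ny.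
  + exact: Or33.
- move=> x; have [ltx|gex] := ltnP x n; last first.
    by right; exists x.+1 => y lty [] [[]|e|[]]; lia.
  have [Nx|Nx] := pselect (small_part p x).
    by left; exists n => y ley; apply: Or33.
  by right; exists n => y ley [] [[]|e|[]] *; try lia; apply: Nx.
- move=> k; split=> [x y ltx lty|x y ltx ley _].
    split=> [lxy|]; first exact: Or31.
    by case=> [[]//|->|[]]; [apply: refl|lia].
  split=> [Nx|Nx]; first exact: Or33.
  by case=> [] [[]|e|[]] *; try lia; apply: Nx.
Qed.

Definition retype (p : condition) (k : nat) (le : nat -> nat -> Prop) (b : bool) :=
  Condition k le [set x | if x < bound p then small_part p x else b].

(** Closure of the new small part rests on the old promises. A new number under an old small one
    would equal it by antisymmetry, and an old number under a new one is comparable to it, hence was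
    promised small. *)
Lemma retypeP p k le b : valid p -> realization p le -> bound p <= k ->
  valid (retype p k le b) /\ stronger (retype p k le b) p.
Proof.
move=> [_ closed] [ple _ ext] lek; have [agr sett] := ext k; split; last first.
  by split=> // x ltx /=; rewrite ltx.
split=> // x y ltx lty lxy /=; have [_ _ anti _] := ple.
have [lty' Ny|gey bt] := ltnP y (bound p); have [ltx'|gex] := ltnP x (bound p) => //.
- by apply: closed Ny => //; apply/agr.
- have [/(_ Ny) lyx _] := sett y x lty' gex ltx.
  by move: lty'; rewrite -(anti _ _ lxy lyx) ltnNge gex.
- have [_ iso] := sett x y ltx' gey lty.
  by apply: contrapT => /iso; apply; left.
Qed.

(** * Diagonalization producing both types *)

Definition infinite_type (Q : set nat -> set nat) m b le : Prop :=
  infinite_set (limit_type b (Q (code m le))).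

Lemma realization_limit_type m (b : bool) p le w : realization p le -> w < bound p ->
  (small_part p w <-> b) -> limit_type b (code m le) w.
Proof.
move=> [_ _ ext] ltw Nw; split; first by rewrite carrier_code.
exists (bound p) => y ley _; rewrite order_code; apply/rel_if_oriented.
have [_ /(_ w y ltw ley (ltnSn y))[N1 N2]] := ext y.+1.
by case: b Nw => Nw; [left; apply/N1/Nw|apply: N2 => /Nw].
Qed.

(* If [p] has a realization with infinitely many elements of type [b], then [q]
   gives a committed element the wrong type; otherwise the second clause is void. *)
Lemma diagonal_step Phi Psi Q m b j p : reduces Phi Psi Q -> valid p ->
  exists q, [/\ valid q, stronger q p, bound p < bound q &
    forall le, realization q le -> infinite_type Q m b le ->
      exists2 x, j <= x & limit_type (~~ b) (Q (code m le)) x].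
Proof.
move=> red vp.
have [[le [rle inf]]|none] := pselect (exists le, realization p le /\ infinite_type Q m b le);
    last first.
  have [le rle] := realization_exists vp.
  have [vq qp] := retypeP false vp rle (leqnSn _).
  exists (retype p (bound p).+1 le false); split=> // le' rle' inf.
  by case: none; exists le'; split=> //; apply: realization_stronger rle'.
have [ple st _] := rle.
have inst := code_instance m ple st.
have [c [w [d [u [k [cP lew commit]]]]]] := commitment j (bound p) red inst inf.
(* Freezing the order below [l] protects the use [u] and puts [w] among the retyped numbers, as [w]
   is not below [bound p]. *)
pose l := maxn u w.+1.
have lel : bound p <= l by lia.
have [vq qp] := retypeP (~~ d) vp rle lel.
exists (retype p l le (~~ d)); split=> //=; first by lia.
move=> le' rle' inf'; have [ple' st' ext'] := rle'.
have [||||x cx tx] := commit (code m le').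
- exact: code_instance.
- apply: agree_code => x y ltx lty; have [agr _] := ext' 0.
  by case: m {inst inf inf' commit cP} => /=; apply: agr => /=; lia.
- exact: inf'.
- apply: (realization_limit_type m rle') => /=; first by lia.
  by rewrite ltnNge lew.
by exists x => //; have [] := cP x cx.
Qed.

(** The bounds increase strictly, so stage [i] decides all numbers below [i], and [x], [y] can be
    compared at stage [(maxn x y).+1]. *)
Lemma realization_limit (p : nat -> condition) :
    (forall i, valid (p i)) -> (forall i, stronger (p i.+1) (p i)) ->
    (forall i, bound (p i) < bound (p i.+1)) ->
  exists le, forall i, realization (p i) le.
Proof.
move=> vp pS ltp.
have le_bound i : i <= bound (p i).
  by elim: i => // i IH; apply: leq_ltn_trans (ltp i).
have mono i j : i <= j -> stronger (p j) (p i).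
  move=> /subnK <-; elim: (j - i) => [|d IH]; first exact: stronger_refl.
  exact: stronger_trans IH (pS _).
have agr i j x y : x < bound (p i) -> y < bound (p i) ->
    x < bound (p j) -> y < bound (p j) -> below (p i) x y <-> below (p j) x y.
  wlog lij : i j / i <= j => [H|].
    have [/H|/ltnW/H H'] := leqP i j; first exact.
    by move=> *; rewrite H'.
  by move=> ltx lty _ _; have [_ [-> //]] := mono i j lij.
pose le x y := below (p (maxn x y).+1) x y.
have leE i x y : x < bound (p i) -> y < bound (p i) -> below (p i) x y <-> le x y.
  by move=> ltx lty; apply: agr => //; apply: leq_trans (le_bound _); lia.
have ext i k : extends_upto k (p i) le.
  split=> [x y|x y ltx ley lty]; first exact: leE.
  have [lep [_ sett] _] := mono i (maxn i y.+1) (leq_maxl _ _).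
  have lty' : y < bound (p (maxn i y.+1)) by apply: leq_trans (le_bound _); lia.
  have ltx' := leq_trans ltx lep.
  have := sett x y ltx ley lty'.
  by rewrite /settled /comparable !(leE (maxn i y.+1)).
have bnd x i : x < i -> x < bound (p i) by move=> lt; apply: leq_trans (le_bound i).
exists le => i; split=> // [|x].
  split=> // [x _|x y|x y z].
  - by have [[_ refl _ _] _] := vp (maxn x x).+1; apply: refl.
  - pose k := (maxn x y).+1; have [[_ _ anti _] _] := vp k.
    by rewrite -!(leE k); try (apply: bnd; lia); apply: anti.
  - pose k := (maxn x (maxn y z)).+1; have [[_ _ _ trans] _] := vp k.
    by rewrite -!(leE k); try (apply: bnd; lia); apply: trans.
have ltx := bnd x x.+1 (ltnSn x).
have sett y : bound (p x.+1) <= y -> settled le (small_part (p x.+1)) x y.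
  by move=> ley; have [_ /(_ x y ltx ley (ltnSn y))] := ext x.+1 y.+1.
have [Nx|Nx] := pselect (small_part (p x.+1) x); [left|right];
  exists (bound (p x.+1)) => y /sett[N1 N2]; [exact: N1|exact: N2].
Qed.

(** Stage [i] treats type [odd i] with threshold [i./2], so every pair of a type and a threshold is
    met. In the limit, infinitely many elements of one type force infinitely many of the other, and
    some type is infinite because the carrier is. *)
Lemma mixed_realization Phi Psi Q m p : reduces Phi Psi Q -> valid p ->
  exists le, realization p le /\ forall b, infinite_type Q m b le.
Proof.
move=> red vp.
have /choice[f Hf] : forall pi : condition * nat, exists q, valid pi.1 ->
    [/\ valid q, stronger q pi.1, bound pi.1 < bound q &
    forall le, realization q le -> infinite_type Q m (odd pi.2) le ->
      exists2 x, pi.2./2 <= x & limit_type (~~ odd pi.2) (Q (code m le)) x].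
  move=> [q i] /=; have [vq|nvq] := pselect (valid q); last by exists q.
  by have [r Hr] := diagonal_step m (odd i) i./2 red vq; exists r.
pose s := fix s i := if i is i'.+1 then f (s i', i') else p.
have vs i : valid (s i).
  by elim: i => //= i IH; have [] := Hf (s i, i) IH.
have [||le rle] := realization_limit vs.
- by move=> i; have [] := Hf (s i, i) (vs i).
- by move=> i; have [] := Hf (s i, i) (vs i).
have [ple st _] := rle 0.
have [_ [instQ _] _] := red _ (code_instance m ple st).
have flip b : infinite_type Q m b le -> infinite_type Q m (~~ b) le.
  move=> infb; apply/infinite_natP => j.
  have [_ _ _ /(_ le (rle _.+1))] := Hf (s (b + j.*2), b + j.*2) (vs _).
  by rewrite /= half_bit_double oddD odd_double addbF oddb; apply.
exists le; split; first exact: (rle 0).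
have [b infb] : exists b, infinite_type Q m b le.
  apply: contrapT => none.
  have fin b : finite_set (limit_type b (Q (code m le))).
    by apply: contrapT => inf; apply: none; exists b.
  have [_ + _] := instQ; apply.
  apply: (sub_finite_set (B := limit_type true (Q (code m le)) `|`
                               limit_type false (Q (code m le)))).
    by move=> x /(limit_type_total instQ)[[] tx]; [left|right].
  by rewrite finite_setU.
by move=> b'; have := flip _ infb; move: infb; case: b b' => -[].
Qed.

(** * Assigning two wrong types at once *)

(** For opposite types, take the cone under the element meant to be small. By antisymmetry, one of
    the two orientations leaves the other element outside it. *)
Lemma mixed_types le (w w' : nat) (t t' : bool) : is_poset setT le -> w <> w' ->
  exists m (N : set nat), [/\ forall x y, oriented m le x y -> N y -> N x,
    N w <-> t & N w' <-> t'].
Proof.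
move=> ple ww'; have [_ refl anti trans] := ple.
have down v v' : v <> v' -> exists m (N : set nat),
    [/\ forall x y, oriented m le x y -> N y -> N x, N v & ~ N v'].
  move=> vv'.
  have [m nle] : exists m, ~ oriented m le v' v.
    have [le1|nle1] := pselect (le v' v); last by exists true.
    by exists false => /= le2; apply: vv'; apply: anti.
  have [_ refl' _ trans'] := poset_oriented m ple.
  exists m, [set x | oriented m le x v]; split=> // [x y lxy lyv|].
    exact: trans' lxy lyv.
  exact: refl'.
case: t; case: t'.
- by exists true, setT.
- have [m [N [clo Nw Nw']]] := down w w' ww'.
  by exists m, N; split=> //; split.
- have [m [N [clo Nw Nw']]] := down w' w (nesym ww').
  by exists m, N; split=> //; split.
- by exists true, set0.
Qed.

Theorem theorem8 : ~ sW_reducible SCAC omega_SCAC.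
Proof.
move=> [Phi [Psi red0]].
have /choice[Q red] : forall X, exists X', instance SCAC X ->
    [/\ computes Phi X X', instance omega_SCAC X' &
        forall Y', solution SCAC X' Y' ->
          exists2 Y, computes Psi Y' Y & solution SCAC X Y].
  move=> X; have [instX|ninst] := pselect (instance SCAC X); last by exists X.
  by have [X' HX'] := red0 X instX; exists X'.
have {red0} red : reduces Phi Psi Q := red.
pose p0 := Condition 0 (@eq nat) set0.
have vp0 : valid p0.
  by split=> //; split=> // [x y z -> ->].
have [le0 [[ple0 st0 _] mixed0]] := mixed_realization true red vp0.
have inst0 := code_instance true ple0 st0.
have [_ instQ0 _] := red _ inst0.
set X0 := code true le0 in inst0 instQ0.
have [c [w [d [u [k [cP _ commit]]]]]] := commitment 0 0 red inst0 (mixed0 true).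
(* Past [l], everything in [Q X0] is comparable to all of the finite chain [c]. *)
have [l Hl] : exists l, forall x, x < k -> c x -> forall y, l <= y ->
    carrier (Q X0) y -> comparable (order (Q X0)) x y.
  apply: uniform_bound => [x i i' lei Hi cx y ley|x _].
    by apply: Hi => //; apply: leq_trans ley.
  have [cx|ncx] := pselect (c x); last by exists 0.
  by have [_ _ [_ [i Hi]]] := cP x cx; exists i.
(* The threshold [maxn l k] places [c'] beyond [c] and [l], and [w.+1] makes [w'] differ from
   [w]. *)
have [c' [w' [d' [u' [k' [c'P leww' commit']]]]]] :=
  commitment (maxn l k) w.+1 red inst0 (mixed0 false).
have [u'' agQ] := reduces_use (maxn k k') red inst0.
have ww' : w <> w' by lia.
have [m [N [closed Nw Nw']]] := mixed_types (~~ d) (~~ d') ple0 ww'.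
pose n := maxn (maxn u u') (maxn u'' w'.+1).
pose p1 := Condition n (oriented m le0) N.
have vp1 : valid p1.
  split=> /= [|x y _ _]; [exact: poset_oriented|exact: closed].
have [le1 [rle1 mixed1]] := mixed_realization m red vp1.
have [ple1 st1 ext1] := rle1.
have inst1 := code_instance m ple1 st1.
have [_ instQ1 _] := red _ inst1.
(* [p1] starts from [oriented m le0] and [code m] reverses it back, so [X0] is preserved below [n]
   even when [m] is [false]. *)
have ag : agree n X0 (code m le1).
  apply: agree_code => x y ltx lty; have [/= agr _] := ext1 0.
  have := agr x y ltx lty; have := agr y x lty ltx.
  by case: m {closed p1 vp1 rle1 mixed1 ext1 inst1 instQ1 agr}.
have [||x cx isox] := commit _ inst1 (agreeW _ ag) (mixed1 true).
- by lia.
- by apply: (realization_limit_type m rle1) => //=; lia.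
have [||y c'y smally] := commit' _ inst1 (agreeW _ ag) (mixed1 false).
- by lia.
- by apply: (realization_limit_type m rle1) => //=; lia.
have [_ ltxk _] := cP x cx; have [lelky ltyk' [Zy _]] := c'P y c'y.
(* The two are comparable since [y] is at least [l], and [x < k <= y] excludes the other direction
   in an $\omega$-ordered poset. *)
have lexy : order (Q X0) x y.
  have ley : l <= y by lia.
  have [//|lyx] := Hl x ltxk cx y ley Zy.
  by have [_ /(_ _ _ lyx)] := instQ0; lia.
have [|_ agO] := agQ _ inst1 (agreeW _ ag); first by lia.
have {}lexy : order (Q (code m le1)) x y by apply/agO => //; lia.
have [[_ infQ1 _] _] := instQ1.
exact: limit_typeN infQ1 (limit_type_incr instQ1 lexy smally) isox.
Qed.
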